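(* In the Strong Ramsey game $\mathcal{R}(K_{\aleph_0}, \hat{K}_{2,3})$, the first player $P_1$ has a winning strategy.
   Context: For $k$-uniform hypergraphs $B$ (the board, possibly infinite) and $G$ (the target graph, finite), the Strong Ramsey game $\mathcal{R}(B,G)$ is played by two players $P_1$ and $P_2$ who alternately claim (color in their own color) previously unclaimed edges of $B$, with $P_1$ moving first. The first player to claim all edges of a copy of $G$ in their own color wins; if neither player does so within finitely many moves, the game is a draw. Here $K_{\aleph_0}$ is the complete graph on a countably infinite vertex set. For $t \in \mathbb{N}$, $\hat{K}_{2,t}$ denotes the complete bipartite graph $K_{2,t}$ together with the edge joining the two vertices of the part of size $2$. *)

(* Defs.v *)
From mathcomp Require Import all_boot finmap.

Set Implicit Arguments.
Unset Strict Implicit.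
Unset Printing Implicit Defensive.

Local Open Scope fset_scope.

Record hypergraph (k : nat) (V : choiceType) := Hypergraph {
  edge : {fset V} -> Prop;
  edge_card : forall e, edge e -> #|` e| = k }.

Definition complete_graph (V : choiceType) : hypergraph 2 V :=
  @Hypergraph 2 V (fun e => #|` e| = 2) (fun _ => id).

(* K_{2,t} plus the edge inside the part of size 2, on the disjoint union of
   the parts 'I_2 and 'I_t. *)
Definition Khat2_edge (t : nat) (e : {fset ('I_2 + 'I_t)%type}) : Prop :=
  (exists (i : 'I_2) (j : 'I_t), e = [fset inl i; inr j])
  \/ e = [fset inl ord0; inl ord_max].

Lemma Khat2_edge_card (t : nat) (e : {fset ('I_2 + 'I_t)%type}) :
  Khat2_edge e -> #|` e| = 2.
Proof. by case=> [[i [j ->]]|->]; rewrite cardfs2. Qed.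

Definition Khat2 (t : nat) : hypergraph 2 ('I_2 + 'I_t)%type :=
  Hypergraph (@Khat2_edge_card t).

Definition player := bool.
Definition P1 : player := false.
Definition P2 : player := true.
Definition opponent (p : player) : player := ~~ p.

Section StrongRamseyGame.

Variables (k : nat) (V : choiceType) (W : finType).
Variables (B : hypergraph k V) (G : hypergraph k W).

(* The move None is a forced pass, legal only when every edge of the board has
   been claimed; it makes every run infinite, also on a finite board. *)
Definition move := option {fset V}.

(* Moves in chronological order: P1 makes those at even positions, P2 those at
   odd positions. *)
Definition history := seq move.

Definition player_at (n : nat) : player := odd n.

Definition claimed (p : player) (h : history) (e : {fset V}) : Prop :=
  exists i, player_at i = p /\ nth None h i = Some e.

Definition unclaimed (h : history) (e : {fset V}) : Prop :=
  edge B e /\ Some e \notin h.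

Definition legal_move (h : history) (m : move) : Prop :=
  match m with
  | Some e => unclaimed h e
  | None => forall e, ~ unclaimed h e
  end.

Definition legal_history (h : history) : Prop :=
  forall i, i < size h -> legal_move (take i h) (nth None h i).

Definition run := nat -> move.

Definition legal_run (r : run) : Prop :=
  forall n, legal_move (mkseq r n) (r n).

Definition contains_copy (S : {fset V} -> Prop) : Prop :=
  exists f : W -> V,
    injective f /\ forall e, edge G e -> S [fset f x | x in e].

(* Runs are continued after the game has been decided. Claimed sets only grow,
   so p is the first to complete a copy of G iff at some time p owns a copy
   and the opponent does not own one yet. *)
Definition wins (p : player) (r : run) : Prop :=
  exists n, contains_copy (claimed p (mkseq r n))
         /\ ~ contains_copy (claimed (opponent p) (mkseq r n)).

Definition strategy := history -> move.

Definition legal_strategy (p : player) (s : strategy) : Prop :=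
  forall h, legal_history h -> player_at (size h) = p -> legal_move h (s h).

Definition follows (p : player) (s : strategy) (r : run) : Prop :=
  forall n, player_at n = p -> r n = s (mkseq r n).

Definition has_winning_strategy (p : player) : Prop :=
  exists s : strategy, legal_strategy p s
    /\ forall r, legal_run r -> follows p s r -> wins p r.

End StrongRamseyGame.

(* Main.v *)
Require Import Defs.
From mathcomp Require Import all_boot finmap.
From mathcomp Require Import zify.
From Stdlib Require Import Classical_Prop IndefiniteDescription.

Set Implicit Arguments.
Unset Strict Implicit.
Unset Printing Implicit Defensive.

(* Call K_4 minus an edge a 2-book; its spine is the edge st in both triangles
   stp and stq.  If P1 owns a 2-book, has the move, and P2 cannot complete a copy
   with one edge, then P1 wins by threats: he claims s y for fresh vertices y,
   each time forcing P2 to take t y, until s has three such neighbours y1, y2,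
   y3; then p y1 turns sp into a spine with pages t and y1, and P2 cannot block
   both p y2 and p y3.  The forced edges t y help P2 only if t is on the spine of
   a 2-book of P2.  Two 2-books of P2 whose spines meet s and t respectively
   have at least 8 edges, so while P2 owns at most 7 edges one of the two
   orientations of st is good.  A triangle abc with a pendant edge ad, where db
   and dc are unclaimed, gives P1 two ways to complete a 2-book, so it suffices
   to reach such a configuration before P2 has made enough progress; a fixed
   strategy of depth at most six does this, and its correctness is a finite
   computation, all vertices not yet touched being interchangeable. *)

(** * The game on vertex-labelled positions *)

Notation edges := (seq (nat * nat)).

Definition same (x y : nat) (e : nat * nat) : bool :=
  (e.1 == x) && (e.2 == y) || (e.1 == y) && (e.2 == x).

Definition adj (E : edges) (x y : nat) : bool := has (same x y) E.

Arguments same : simpl never.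
Arguments adj : simpl never.

(** The copy of $\hat{K}_{2,3}$ with spine [u v] and pages [w1], [w2], [w3]. *)
Definition book_edges (u v w1 w2 w3 : nat) : edges :=
  [:: (u, v); (u, w1); (v, w1); (u, w2); (v, w2); (u, w3); (v, w3)].

Definition missing (B L : edges) : nat :=
  count (fun e => ~~ adj B e.1 e.2) L.

Definition book (E : edges) : Prop :=
  exists u v w1 w2 w3, uniq [:: u; v; w1; w2; w3]
    /\ missing E (book_edges u v w1 w2 w3) = 0.

Definition free (R B : edges) (x y : nat) : bool :=
  [&& x != y, ~~ adj R x y & ~~ adj B x y].

(* P1 owns R, P2 owns B, and P1 is to move. *)
Inductive win : edges -> edges -> Prop :=
| win_now R B x y : free R B x y -> book ((x, y) :: R) -> ~ book B -> win R B
| win_step R B x y : free R B x y ->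
    (forall u v, free ((x, y) :: R) B u v ->
       win ((x, y) :: R) ((u, v) :: B)) ->
    win R B.

(** * Invariance under renaming of vertices *)

Lemma sameC x y e : same x y e = same y x e.
Proof. by rewrite /same orbC. Qed.

Lemma adjC E x y : adj E x y = adj E y x.
Proof. by apply: eq_has => e; rewrite sameC. Qed.

Lemma adj_cons e E x y : adj (e :: E) x y = same x y e || adj E x y.
Proof. by []. Qed.

Lemma freeC R B x y : free R B x y = free R B y x.
Proof. by rewrite /free eq_sym (adjC R) (adjC B). Qed.

Lemma book_iso (f g : nat -> nat) E E' : cancel f g ->
  (forall x y, adj E' (f x) (f y) = adj E x y) -> book E -> book E'.
Proof.
move=> fg eqE [u [v [w1 [w2 [w3 [U M]]]]]].
exists (f u), (f v), (f w1), (f w2), (f w3); split.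
  by rewrite -[X in uniq X]/(map f [:: u; v; w1; w2; w3]) map_inj_uniq //; apply: can_inj fg.
by move: M; rewrite /missing /= !eqE.
Qed.

(** [f] carries P1's moves to the renamed position, [g] pulls P2's replies back. Comparing adjacency
    only makes the order and orientation of listed edges immaterial. *)
Lemma win_iso (f g : nat -> nat) R B R' B' : cancel f g -> cancel g f ->
  (forall x y, adj R' (f x) (f y) = adj R x y) ->
  (forall x y, adj B' (f x) (f y) = adj B x y) -> win R B -> win R' B'.
Proof.
move=> fg gf eqR eqB W; elim: W R' B' eqR eqB => {}R {}B x y F.
  move=> Bk nBk R' B' eqR eqB; apply: (@win_now _ _ (f x) (f y)).
  - by rewrite /free eqR eqB (can_eq fg).
  - apply: (book_iso fg) Bk => a b.
    by rewrite !adj_cons eqR /same /= !(can_eq fg).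
  - move=> bB; apply: nBk; apply: (book_iso gf) bB => a b.
    by rewrite -eqB !gf.
move=> _ IH R' B' eqR eqB; apply: (@win_step _ _ (f x) (f y)).
  by rewrite /free eqR eqB (can_eq fg).
have eqR1 a b : adj ((f x, f y) :: R') (f a) (f b) = adj ((x, y) :: R) a b.
  by rewrite !adj_cons eqR /same /= !(can_eq fg).
move=> u v Fuv; apply: (IH (g u) (g v)) => //.
  by rewrite /free -eqR1 -eqB !gf (can_eq gf).
by move=> a b; rewrite -{1}(gf u) -{1}(gf v) !adj_cons eqB /same /= !(can_eq fg).
Qed.

Lemma win_swap_last R B u v : win R ((u, v) :: B) -> win R ((v, u) :: B).
Proof.
move=> W; apply: (@win_iso id id _ _ _ _ _ _ _ _ W) => // x y.
by rewrite !adj_cons; congr (_ || _); rewrite /same /= orbC andbC (andbC (v == x)).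
Qed.

Definition swap (a b x : nat) : nat := if x == a then b else if x == b then a else x.

Lemma swapK a b : involutive (swap a b).
Proof.
move=> x; rewrite /swap; case: (eqVneq x a) => [->|xa].
  by rewrite eqxx; case: eqVneq.
case: (eqVneq x b) => [->|xb]; first by rewrite eqxx.
by rewrite (negPf xa) (negPf xb).
Qed.

Definition vertices (E : edges) : seq nat := undup (flatten [seq [:: e.1; e.2] | e <- E]).

Lemma adj_vertices E x y : adj E x y -> (x \in vertices E) && (y \in vertices E).
Proof.
rewrite !mem_undup; elim: E => //= e E IH; rewrite adj_cons !inE.
case/orP=> [|/IH/andP[-> ->]]; last by rewrite !orbT.
by case/orP => /andP[/eqP-> /eqP->]; rewrite !eqxx !orbT.
Qed.

Lemma adj_swap E a b x y : a \notin vertices E -> b \notin vertices E ->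
  adj E (swap a b x) (swap a b y) = adj E x y.
Proof.
move=> Ha Hb.
suff H u v : adj E u v -> adj E (swap a b u) (swap a b v).
  by apply/idP/idP => [/H|/H //]; rewrite !swapK.
move=> A; have /andP[Hu Hv] := adj_vertices A.
have K w : w \in vertices E -> swap a b w = w.
  move=> Hw; rewrite /swap.
  case: eqP => [E1|_]; first by rewrite -E1 Hw in Ha.
  by case: eqP => [E1|_]; first by rewrite -E1 Hw in Hb.
by rewrite !K.
Qed.

(** Transposing two vertices untouched by [R] and [B] fixes both colour classes, so it acts only on
    P2's last edge. *)
Lemma win_swap R B a b u v :
  a \notin vertices R -> b \notin vertices R ->
  a \notin vertices B -> b \notin vertices B ->
  win R ((u, v) :: B) -> win R ((swap a b u, swap a b v) :: B).
Proof.
move=> aR bR aB bB; apply: (win_iso (swapK a b) (swapK a b)) => x y.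
  exact: adj_swap.
by rewrite !adj_cons adj_swap // /same /= !(can_eq (swapK a b)).
Qed.

(** * Counting the edges P2 still lacks *)

Definition blocked (R B L : edges) : bool :=
  has (fun e => adj R e.1 e.2 && ~~ adj B e.1 e.2) L.

(* Every copy of the target still available to P2 lacks more than k edges of B. *)
Definition safe (k : nat) (R B : edges) : Prop :=
  forall u v w1 w2 w3, uniq [:: u; v; w1; w2; w3] ->
    let L := book_edges u v w1 w2 w3 in blocked R B L \/ k < missing B L.

(** Distinctness as unordered pairs, phrased by counting so that one edge of P2 accounts for at most
    one entry of [L]. *)
Definition simple (L : edges) : Prop := forall x y, count (same x y) L <= 1.

Lemma sameE x y u v : same x y (u, v) = (u == x) && (v == y) || (u == y) && (v == x).
Proof. by []. Qed.

Lemma same_sym x y u v : same x y (u, v) = same u v (x, y).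
Proof.
by rewrite !sameE ![x == _]eq_sym ![y == _]eq_sym [(v == x) && _]andbC.
Qed.

Lemma pairwise_simple L : pairwise (fun e f => ~~ same f.1 f.2 e) L -> simple L.
Proof.
elim: L => [|[u v] L IH] //= /andP[/allP D /IH S] x y.
rewrite /=; case H: (same x y (u, v)); last exact: S.
rewrite (_ : count _ L = 0) //; apply/eqP; rewrite -leqn0 leqNgt -has_count.
apply/hasP => -[[a b] /D]; rewrite !sameE /=; move: H; rewrite sameE.
by case/orP => /andP[/eqP<- /eqP<-] /negP nS /orP H; apply: nS;
  case: H => /andP[/eqP-> /eqP->]; rewrite !eqxx ?orbT.
Qed.

Ltac neqs := repeat match goal with
  | H : is_true (_ && _) |- _ => case/andP: H => ? ?
  | H : is_true (~~ (_ || _)) |- _ => rewrite negb_or in H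
  end.
Ltac simpl_neqs := repeat match goal with
  | H : is_true (?a != ?b) |- context [?a == ?b] => rewrite (negPf H)
  | H : is_true (?a != ?b) |- context [?b == ?a] => rewrite (eq_sym b a) (negPf H)
  end.

Lemma book_edges_simple u v w1 w2 w3 :
  uniq [:: u; v; w1; w2; w3] -> simple (book_edges u v w1 w2 w3).
Proof.
rewrite /= !inE => U; apply: pairwise_simple; neqs.
by rewrite /= !sameE; simpl_neqs; rewrite !(andbF, orbF).
Qed.

(** Five edges of a 2-book with spine [t z], then three edges at the end [s] of another spine. The
    latter contain [s], which the first 2-book avoids. *)
Lemma forked_simple t z p q s z' p' q' :
  uniq [:: t; z; p; q] -> uniq [:: s; z'; p'; q'] ->
  s \notin [:: t; z; p; q] -> t \notin [:: z'; p'; q'] ->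
  simple [:: (t, z); (t, p); (t, q); (z, p); (z, q); (s, z'); (s, p'); (s, q')].
Proof.
rewrite /= !inE => U U' S T; apply: pairwise_simple; neqs.
by rewrite /= !sameE; simpl_neqs; rewrite !(andbF, orbF).
Qed.

Lemma count_adj_le B L : simple L -> count (fun e => adj B e.1 e.2) L <= size B.
Proof.
move=> S; elim: B => [|[x y] B IH] /=; first by rewrite (eq_count (a2 := pred0)) ?count_pred0.
rewrite -add1n; apply: leq_trans (leq_add (S x y) IH).
rewrite -count_predUI; apply: leq_trans (leq_addr _ _).
apply: sub_count => -[a b]; rewrite adj_cons /= !sameE => /orP[|->]; last by rewrite orbT.
by case/orP=> /andP[/eqP-> /eqP->]; rewrite !eqxx ?orbT.
Qed.

Lemma missing_adj B L : missing B L + count (fun e => adj B e.1 e.2) L = size L.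
Proof. by rewrite addnC count_predC. Qed.

Lemma missing_cons x y B L : simple L -> missing B L <= (missing ((x, y) :: B) L).+1.
Proof.
move=> S; rewrite -addn1; apply: leq_trans (leq_add (leqnn _) (S x y)).
rewrite -count_predUI; apply: leq_trans (leq_addr _ _).
apply: sub_count => -[a b] /= nB.
by rewrite adj_cons negb_or nB andbT same_sym orNb.
Qed.

Lemma safe_small k R B : k + size B < 7 -> safe k R B.
Proof.
move=> H u v w1 w2 w3 U L; right.
have := missing_adj B L; have := count_adj_le B (book_edges_simple U); rewrite -/L /=; lia.
Qed.

Lemma safe_mine k e R B : safe k R B -> safe k (e :: R) B.
Proof.
move=> S u v w1 w2 w3 U L; case: (S _ _ _ _ _ U) => [Bl|]; [left | by right].
by apply: sub_has Bl => f /andP[Rf Bf]; rewrite adj_cons Rf orbT.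
Qed.

(** A blocked copy stays blocked, since P2 cannot take an edge of P1; in any other copy one reply
    fills at most one gap. *)
Lemma safe_reply k R B u v : safe k.+1 R B -> free R B u v -> safe k R ((u, v) :: B).
Proof.
move=> S /and3P[_ nR _] a b w1 w2 w3 U L; case: (S _ _ _ _ _ U) => [Bl|lt]; [left | right].
  apply: sub_has Bl => -[x y] /= /andP[Rf Bf]; rewrite Rf adj_cons negb_or Bf andbT /=.
  apply: contra nR; rewrite sameE => /orP[/andP[/eqP-> /eqP->]|/andP[/eqP-> /eqP->]] //.
  by rewrite adjC.
by rewrite -ltnS; apply: leq_trans lt (missing_cons _ _ _ (book_edges_simple U)).
Qed.

Lemma safe_not_book k R B : safe k R B -> ~ book B.
Proof.
move=> S [u [v [w1 [w2 [w3 [U M]]]]]]; case: (S _ _ _ _ _ U); last by rewrite M.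
case/hasP => e eL /andP[_ nB]; move/eqP: M; rewrite -leqn0 leqNgt -has_count.
by case/negP; apply/hasP; exists e.
Qed.

(** * 2-books and their spines *)

Definition book2 (E : edges) (s t p q : nat) : bool :=
  uniq [:: s; t; p; q]
  && all (fun e => adj E e.1 e.2) [:: (s, t); (s, p); (s, q); (t, p); (t, q)].

Definition spine_free (t : nat) (B : edges) : Prop :=
  forall z p q, ~~ book2 B t z p q.

Lemma book2_swap E s t p q : book2 E s t p q -> book2 E t s p q.
Proof.
rewrite /book2 /= !inE !andbT => /andP[U /and5P[st sp sq tp tq]].
rewrite (adjC E t s) st sp sq tp tq; neqs.
by simpl_neqs.
Qed.

(** The 2-book at [t] avoids [s], because P2 does not own [s t]. A 2-book with [s] on its spine
    would add three edges to its five, making eight. *)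
Lemma spine_freeP s t z p q B : size B <= 7 -> s != t -> ~~ adj B s t ->
  book2 B t z p q -> spine_free s B.
Proof.
move=> sz ts nst b z' p' q'; apply/negP => b'.
have U := proj1 (andP b); have U' := proj1 (andP b').
move: (proj2 (andP b)) (proj2 (andP b')) => /=.
rewrite !andbT => /and5P[tz tp tq zp zq] /and5P[sz' sp' sq' _ _].
have ns x : adj B t x -> s != x by apply: contraTneq => <-; rewrite adjC.
have nt x : adj B s x -> t != x by apply: contraTneq => <-.
have := @forked_simple t z p q s z' p' q' U U'.
rewrite !inE !negb_or ts !ns // !nt // => /(_ isT isT) /(@count_adj_le B).
by rewrite /= tz tp tq zp zq sz' sp' sq' /= => /leq_trans/(_ sz).
Qed.

Definition bound (E : edges) : nat := \max_(e <- E) maxn e.1 e.2.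

Lemma adj_bound E x y : adj E x y -> x <= bound E.
Proof.
case/hasP=> -[a b] eE; rewrite sameE => H.
apply: (@leq_trans (maxn a b)); last first.
  exact: (@leq_bigmax_seq _ _ xpredT (fun e => maxn e.1 e.2) _ eE).
by case/orP: H => /andP[/eqP-> /eqP->]; rewrite ?leq_maxl ?leq_maxr.
Qed.

Lemma fresh_vertex (E : edges) (l : seq nat) :
  exists2 y, forall x, adj E x y = false & y \notin l.
Proof.
pose n := maxn (bound E) (\max_(x <- l) x).
exists n.+1 => [x|].
  by apply/negP; rewrite adjC => /adj_bound; rewrite leqNgt ltnS leq_maxl.
apply/negP => /(@leq_bigmax_seq _ _ xpredT id) /(_ isT).
by rewrite leqNgt ltnS leq_maxr.
Qed.

(** * Winning from a 2-book *)

Ltac count_up := rewrite /= ?(add1n, addnS, add0n) //.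

(** P2's only edge at [y] is [t y]. If [y] is on the spine of a copy, at least three of the four
    edges there are missing. If [y] is a page, both its edges are missing unless [t] is on the
    spine; then one is, and a second is missing from the other two pages, as [t] is on no spine of a
    2-book. *)
Lemma safe_pendant R B t y : t != y -> ~~ adj R t y -> (forall x, adj B x y = false) ->
  spine_free t B -> safe 1 R B -> safe 1 R ((t, y) :: B).
Proof.
move=> ty nR yB tB S a b w1 w2 w3 U L.
have Ay x : adj ((t, y) :: B) y x = (x == t).
  by rewrite adj_cons adjC yB orbF sameE eqxx andbT (negPf ty) /= eq_sym.
have Ny x : adj ((t, y) :: B) x y = (x == t) by rewrite adjC.
have AB x z : x != y -> z != y -> adj ((t, y) :: B) x z = adj B x z.
  move=> xy zy; rewrite adj_cons sameE; simpl_neqs.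
  by rewrite !andbF.
case: (S _ _ _ _ _ U) => [Bl|lt].
  left; apply: sub_has Bl => -[c d] /= /andP[Rc Bc]; rewrite Rc adj_cons negb_or Bc andbT /=.
  apply: contra nR; rewrite sameE => /orP[/andP[/eqP-> /eqP->]|/andP[/eqP-> /eqP->]] //.
  by rewrite adjC.
right; move: U lt (tB b w2 w3) (tB a w2 w3) (tB b w1 w3) (tB a w1 w3) (tB b w1 w2) (tB a w1 w2).
rewrite /book2 /missing /L /= !inE !andbT => U.
(* An incomplete 2-book at [t] gives a positive count; the two versions match the edge order of
   [book_edges] for [t] as first and as second spine vertex. *)
have bools b1 b2 b3 b4 b5 : ~~ [&& b1, b2, b3, b4 & b5] ->
  0 < ~~ b1 + (~~ b2 + (~~ b4 + (~~ b3 + (~~ b5 + 0)))) by case: b1 b2 b3 b4 b5; do 4!case.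
have bools' b1 b2 b3 b4 b5 : ~~ [&& b1, b2, b3, b4 & b5] ->
  0 < ~~ b1 + (~~ b4 + (~~ b2 + (~~ b5 + (~~ b3 + 0)))) by case: b1 b2 b3 b4 b5; do 4!case.
have [/eqP ya|ya] := boolP (y == a).
  subst y; neqs; rewrite !Ay => *.
  case: (eqVneq b t) => [?|bt]; [subst b; simpl_neqs; count_up|].
  by case: (eqVneq w1 t) => [?|w1t]; [subst w1|]; simpl_neqs; count_up.
have [/eqP yb|yb] := boolP (y == b).
  subst y; neqs; rewrite !Ay !Ny => *.
  case: (eqVneq a t) => [?|bt]; [subst a; simpl_neqs; count_up|].
  by case: (eqVneq w1 t) => [?|w1t]; [subst w1|]; simpl_neqs; count_up.
have [/eqP yw|y1] := boolP (y == w1).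
  subst y; neqs; rewrite !Ny !AB; simpl_neqs => //.
  case: (eqVneq a t) => [?|at_]; [subst a|case: (eqVneq b t) => [?|bt]; [subst b|]];
    simpl_neqs; last by count_up.
    by move=> /= _ /bools; count_up.
  by rewrite (adjC B a t) => /= _ _ /bools'; count_up.
have [/eqP yw|y2] := boolP (y == w2).
  subst y; neqs; rewrite !Ny !AB; simpl_neqs => //.
  case: (eqVneq a t) => [?|at_]; [subst a|case: (eqVneq b t) => [?|bt]; [subst b|]];
    simpl_neqs; last by count_up.
    by move=> /= _ _ _ /bools; count_up.
  by rewrite (adjC B a t) => /= _ _ _ _ /bools'; count_up.
have [/eqP yw|y3] := boolP (y == w3).
  subst y; neqs; rewrite !Ny !AB; simpl_neqs => //.
  case: (eqVneq a t) => [?|at_]; [subst a|case: (eqVneq b t) => [?|bt]; [subst b|]];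
    simpl_neqs; last by count_up.
    by move=> /= _ _ _ _ _ /bools; count_up.
  by rewrite (adjC B a t) => /= _ _ _ _ _ _ /bools'; count_up.
by rewrite !AB ?[_ == y]eq_sym.
Qed.

Lemma win_ext R B B' : (forall x y, adj B' x y = adj B x y) -> win R B -> win R B'.
Proof. by move=> eqB W; apply: (@win_iso id id _ _ _ _ _ _ _ _ W) => // x y; rewrite eqB. Qed.

Lemma adj_cons_same x y E u v : same x y (u, v) ->
  forall a b, adj ((x, y) :: E) a b = adj ((u, v) :: E) a b.
Proof.
rewrite sameE => S a b; rewrite !adj_cons; congr (_ || _).
case/orP: S => /andP[/eqP-> /eqP->] //.
by rewrite !sameE orbC andbC (andbC (x == a)).
Qed.

Lemma free_cons R B e x y : free R (e :: B) x y = ~~ same x y e && free R B x y.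
Proof. by rewrite /free adj_cons negb_or; case: (same x y e); rewrite ?andbF. Qed.

Lemma free_mine R B e x y : free (e :: R) B x y = ~~ same x y e && free R B x y.
Proof. by rewrite /free adj_cons negb_or; case: (same x y e); rewrite ?andbF. Qed.

Lemma bookI E u v w1 w2 w3 : uniq [:: u; v; w1; w2; w3] ->
  all (fun e => adj E e.1 e.2) (book_edges u v w1 w2 w3) -> book E.
Proof.
move=> U A; exists u, v, w1, w2, w3; split=> //; apply/eqP.
rewrite -leqn0 leqNgt -has_count; apply/negP => /hasP[e eL].
by rewrite (allP A).
Qed.

(** Every vertex of a 2-book has degree at least two in it, while [y] has degree one. *)
Lemma spine_free_pendant B t y : t != y -> (forall x, adj B x y = false) ->
  spine_free t B -> spine_free t ((t, y) :: B).
Proof.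
move=> ty yB tB z p q; apply/negP; rewrite /book2 /= !inE !andbT.
move=> /andP[U /and5P[tz tp tq zp zq]]; neqs.
have Ny x : t != x -> adj ((t, y) :: B) x y = false.
  by move=> tx; rewrite adj_cons yB sameE; simpl_neqs.
have nz : z != y by apply: contraTneq zp => ->; rewrite adjC Ny.
have np : p != y by apply: contraTneq zp => ->; rewrite Ny.
have nq : q != y by apply: contraTneq zq => ->; rewrite Ny.
have AB x x' : x' != y -> x != y -> adj ((t, y) :: B) x x' = adj B x x'.
  by move=> *; rewrite adj_cons sameE; simpl_neqs; rewrite !andbF.
have /negP := tB z p q; case.
rewrite /book2 /= !inE -!AB //; simpl_neqs.
by rewrite tz tp tq zp zq.
Qed.

(** [Y] collects the neighbours of [s] gained by threats, each with [p y] still free for the finish;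
    [n] more are wanted. The last two hypotheses survive each forced reply [t y]. *)
Lemma fork_pump n R B s t p q Y : uniq Y -> size Y + n = 3 ->
  (forall y, y \in Y -> [&& adj R s y, free R B p y, y != s & y != t]) ->
  book2 R s t p q -> safe 1 R B -> spine_free t B -> win R B.
Proof.
elim: n R B Y => [|n IH] R B Y UY sY PY B2 S T.
  case: Y UY sY PY => [|y1 [|y2 [|y3 []]]] // UY _ PY.
  have /and4P[s1 f1 ? ?] := PY y1 (mem_head _ _).
  have Py2 : y2 \in [:: y1; y2; y3] by rewrite !inE eqxx orbT.
  have Py3 : y3 \in [:: y1; y2; y3] by rewrite !inE eqxx !orbT.
  have /and4P[s2 f2 ? ?] := PY y2 Py2.
  have /and4P[s3 f3 ? ?] := PY y3 Py3.
  have ? := proj1 (andP f1); have ? := proj1 (andP f2); have ? := proj1 (andP f3).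
  move: (UY) (B2); rewrite /book2 /= !inE !andbT.
  move=> {}UY /andP[U /and5P[st sp sq tp tq]]; neqs.
  apply: (win_step f1) => u v F.
  have nb : ~ book ((u, v) :: B).
    exact: safe_not_book (safe_reply (safe_mine _ S) F).
  have fin y : free ((p, y1) :: R) ((u, v) :: B) p y -> adj R s y -> y1 != y ->
      y != s -> y != t -> win ((p, y1) :: R) ((u, v) :: B).
    move=> Fy sy *; apply: (win_now Fy) => //.
    have ? := proj1 (andP Fy).
    apply: (@bookI _ s p t y1 y).
      by rewrite /= !inE; simpl_neqs.
    by rewrite /= !adj_cons sp st s1 sy (adjC R p) tp !sameE !eqxx !orbT.
  case: (boolP (same p y2 (u, v))) => H2; last first.
    apply: (fin y2) => //; rewrite free_cons free_mine H2 f2 andbT sameE.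
    by simpl_neqs; rewrite !andbF.
  apply: (fin y3) => //; rewrite free_cons free_mine f3 andbT.
  move: H2; rewrite sameE => /orP[]/andP[/eqP? /eqP?]; subst u v.
    by rewrite !sameE; simpl_neqs; rewrite !andbF.
  by rewrite !sameE; simpl_neqs; rewrite !andbF.
have [y yE yl] := fresh_vertex (R ++ B) [:: s; t; p; q].
have yR x : adj R x y = false by move: (yE x); rewrite /adj has_cat => /norP[/negPf].
have yB x : adj B x y = false by move: (yE x); rewrite /adj has_cat => /norP[_ /negPf].
have := yl; rewrite !inE => ?; neqs.
have sy : s != y by rewrite eq_sym.
apply: (@win_step _ _ s y); first by rewrite /free sy yR yB.
have S' := safe_mine (s, y) S.
move=> u v F.
have := B2; rewrite /book2 /= !inE !andbT => /andP[U /and5P[st sp sq tp tq]]; neqs.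
(* Unless P2 answers [t y], that edge completes the copy with spine [s t] and pages [p], [q],
   [y]. *)
case: (boolP (same t y (u, v))) => H; last first.
  apply: (@win_now _ _ t y).
  - rewrite free_cons free_mine /free yR yB H sameE; simpl_neqs.
    by rewrite !andbF.
  - apply: (@bookI _ s t p q y); first by rewrite /= !inE; simpl_neqs.
    by rewrite /= !adj_cons st sp sq tp tq !sameE !eqxx !orbT.
  - exact: safe_not_book (safe_reply S' F).
apply: (win_ext (B := (t, y) :: B)) => [a b|]; first by rewrite (adj_cons_same B H).
apply: (IH _ _ (y :: Y)).
- by rewrite /= UY andbT; apply/negP => /PY /andP[]; rewrite yR.
- by rewrite /= addSnnS.
- move=> y'; rewrite inE => /orP[/eqP->|Yy].
    rewrite adj_cons sameE !eqxx free_mine free_cons /free !yR !yB !sameE; simpl_neqs.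
    by rewrite !andbF.
  have /and4P[sy' f ? ?] := PY _ Yy.
  have ? : y' != y by apply: contraTneq sy' => ->; rewrite yR.
  rewrite adj_cons sy' orbT free_mine free_cons f andbT !sameE; simpl_neqs.
  by rewrite !andbF.
- move: B2; rewrite /book2 => /andP[-> /allP A]; apply/allP => e /A.
  by rewrite adj_cons orbC => ->.
- apply: safe_pendant => //; first by rewrite eq_sym.
  + by rewrite adj_cons yR orbF sameE; simpl_neqs; rewrite !andbF.
- by apply: spine_free_pendant => //; rewrite eq_sym.
Qed.

Lemma fork_win R B s t p q :
  book2 R s t p q -> ~~ adj B s t -> size B <= 7 -> safe 1 R B -> win R B.
Proof.
move=> B2 nst sz S; have /and3P[/= ] := B2.
rewrite !inE => U _ _; neqs.
(* If [t] is on the spine of a 2-book of P2, then [s] is not, and the roles are exchanged so that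
   the forced edges fall at [s]. *)
have [[z [p' [q' b]]]|nb] := classic (exists z p' q', book2 B t z p' q').
  apply: (@fork_pump 3 _ _ t s p q [::]) => //; first exact: book2_swap.
  by apply: spine_freeP sz _ nst b.
apply: (@fork_pump 3 _ _ s t p q [::]) => // z p' q'.
by apply/negP => b; apply: nb; exists z, p', q'.
Qed.

Lemma fork_reply R B s t p q : book2 R s t p q -> ~~ adj B s t -> size B <= 6 ->
  safe 2 R B -> forall u v, free R B u v -> win R ((u, v) :: B).
Proof.
move=> B2 nst sz S u v F; apply: fork_win (B2) _ _ (safe_reply S F) => //.
rewrite adj_cons negb_or nst andbT same_sym.
have /andP[_ /andP[st _]] := B2; have /and3P[_ nR _] := F.
apply: contra nR; rewrite sameE => /orP[/andP[/eqP<- /eqP<-]|/andP[/eqP<- /eqP<-]] //.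
by rewrite adjC.
Qed.

(** Claiming [d b] gives a 2-book with spine [a b], claiming [d c] one with spine [a c]; P2 can stop
    only one. The bounds allow for the two replies P2 makes before [fork_win] applies. *)
Lemma paw_reply R B a b c d :
  uniq [:: a; b; c; d] ->
  all (fun e => adj R e.1 e.2) [:: (a, b); (a, c); (b, c); (a, d)] ->
  all (fun e => ~~ adj B e.1 e.2) [:: (a, b); (a, c)] ->
  free R B d b -> free R B d c -> size B <= 5 -> safe 3 R B ->
  forall u v, free R B u v -> win R ((u, v) :: B).
Proof.
move=> U /= /and5P[ab ac bc ad _] /and3P[nab nac _] Fb Fc sz S u v F.
have S2 := safe_reply S F.
have keep x y : adj R x y -> ~~ adj B x y -> ~~ adj ((u, v) :: B) x y.
  move=> xy nxy; rewrite adj_cons negb_or nxy andbT same_sym.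
  have /and3P[_ nR _] := F.
  apply: contra nR; rewrite sameE => /orP[/andP[/eqP<- /eqP<-]|/andP[/eqP<- /eqP<-]] //.
  by rewrite adjC.
have fin x y : free R B d x -> uniq [:: a; x; y; d] -> adj R a x -> adj R a y -> adj R x y ->
    ~~ adj B a x -> free R ((u, v) :: B) d x -> win R ((u, v) :: B).
  move=> _ U' ax ay xy nax Fx; apply: (win_step Fx).
  apply: (@fork_reply _ _ a x y d) => //.
  - by rewrite /book2 U' /= !adj_cons ax ay ad xy !sameE !eqxx /= ?orbT.
  - exact: keep.
  - exact: safe_mine.
case: (boolP (same d b (u, v))) => H; last first.
  apply: (fin b c) => //.
  by rewrite free_cons H.
apply: (fin c b) => //.
- by move: U; rewrite /= !inE => U; neqs; simpl_neqs.
- by rewrite adjC.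
rewrite free_cons Fc andbT; move: U; rewrite /= !inE => U; neqs.
move: H; rewrite sameE => /orP[]/andP[/eqP? /eqP?]; subst u v;
  by rewrite !sameE; simpl_neqs; rewrite !andbF.
Qed.

(** * Checking a strategy by computation *)

Definition full_page (B : edges) (u v w : nat) : bool := adj B u w && adj B v w.

(* Pages that cost P2 at most one more edge. *)
Definition near_page (R B : edges) (u v w : nat) : bool :=
  [&& w != u, w != v & adj B u w && (adj B v w || ~~ adj R v w)
                       || adj B v w && ~~ adj R u w].

(** A page costs P2 two edges, one less if it is near and one less again if it is full. The sum is
    thus a lower bound for the edges missing from any unblocked copy with spine [u v]. *)
Definition spine_safe (k : nat) (R B : edges) (V : seq nat) (u v : nat) : bool :=
  [|| u == v, adj R u v && ~~ adj B u v
    | k < ~~ adj B u v + (3 - count (full_page B u v) V)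
          + (3 - count (near_page R B u v) V)].

(** A spine vertex untouched by P2 leaves four edges missing, so for [k < 4] only spines inside
    [vertices B] need testing. *)
Definition safeb (k : nat) (R B : edges) : bool :=
  (k + size B < 7)
  || (k < 4) && (let V := vertices B in all (fun u => all (spine_safe k R B V u) V) V).

Lemma count_sub_uniq (T : eqType) (a : pred T) (s1 s2 : seq T) :
  uniq s1 -> {in s1, forall x, a x -> x \in s2} -> count a s1 <= count a s2.
Proof.
move=> U S; rewrite -!size_filter; apply: uniq_leq_size; first exact: filter_uniq.
by move=> x; rewrite !mem_filter => /andP[ax /S ->//]; rewrite ax.
Qed.

Lemma page_costs (z1 z2 z3 o1 o2 o3 : bool) s n m a1 b1 a2 b2 a3 b3 :
  2 <= a1 + b1 + z1 + o1 -> 2 <= a2 + b2 + z2 + o2 -> 2 <= a3 + b3 + z3 + o3 ->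
  z1 + (z2 + (z3 + 0)) <= n -> o1 + (o2 + (o3 + 0)) <= m ->
  s + (3 - n) + (3 - m) <= s + (a1 + (b1 + (a2 + (b2 + (a3 + (b3 + 0)))))).
Proof. lia. Qed.

Lemma safebP k R B : safeb k R B -> safe k R B.
Proof.
case/orP; first exact: safe_small.
case/andP=> k4 /allP chk u v w1 w2 w3 U L.
case Bl: (blocked R B L); [by left | right].
have inV x y : adj B x y -> (x \in vertices B) && (y \in vertices B) by exact: adj_vertices.
have out x : x \notin vertices B -> forall y, adj B x y = false.
  by move=> nx y; apply/negP => /inV /andP[xV _]; rewrite xV in nx.
case: (boolP (u \in vertices B)) => [uV|nu]; last first.
  apply: leq_trans k4 _; rewrite /missing /= !(out u nu) /=.
  by rewrite ?(add1n, addnS, add0n).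
case: (boolP (v \in vertices B)) => [vV|nv]; last first.
  apply: leq_trans k4 _; rewrite /missing /= (adjC B u v) !(out v nv) /=.
  by rewrite ?(add1n, addnS, add0n).
have /allP/(_ v vV) := chk u uV; rewrite /spine_safe.
have UW : uniq [:: w1; w2; w3] by move: U; rewrite /= !inE; case/and3P.
have [uv wu wv] : [/\ u != v, all (fun w => w != u) [:: w1; w2; w3]
    & all (fun w => w != v) [:: w1; w2; w3]].
  by move: U; rewrite /= !inE => U; neqs; split; simpl_neqs.
move: Bl => /negbT; rewrite /blocked /= !negb_or => /and5P[/negPf b0 b1 b1' b2 /and4P[b2' b3 b3' _]].
rewrite (negPf uv) b0 /= => H; apply: leq_trans H _.
have C w : w != u -> w != v ->
    ~~ (adj R u w && ~~ adj B u w) -> ~~ (adj R v w && ~~ adj B v w) ->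
    2 <= (~~ adj B u w + ~~ adj B v w) + full_page B u v w + near_page R B u v w.
  rewrite /full_page /near_page => -> -> /=.
  by case: (adj B u w) (adj B v w) (adj R u w) (adj R v w) => -[] [] [].
have F : full_page B u v w1 + (full_page B u v w2 + (full_page B u v w3 + 0)) <=
    count (full_page B u v) (vertices B).
  by apply: (@count_sub_uniq _ _ [:: w1; w2; w3]) => // w _ /andP[/inV /andP[]].
have N : near_page R B u v w1 + (near_page R B u v w2 + (near_page R B u v w3 + 0)) <=
    count (near_page R B u v) (vertices B).
  apply: (@count_sub_uniq _ _ [:: w1; w2; w3]) => // w _.
  by case/and3P=> _ _ /orP[] /andP[/inV/andP[_ ->]].
move: wu wv; rewrite /= => /and4P[? ? ? _] /and4P[? ? ? _].
by apply: page_costs (C w1 _ _ b1 b1') (C w2 _ _ b2 b2') (C w3 _ _ b3 b3') F N.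
Qed.

(* [If u v p q] branches on whether P2's last edge is uv; [Fork] and [Paw] claim
   their first edge and then win by [fork_reply] and [paw_reply].  Untouched
   vertices entered by P2 are renamed to l and l.+1 in [replies], where l depends
   only on the number of moves, so that one subtree can answer many replies. *)
Inductive plan : Type :=
| Play of nat & nat & plan
| If of nat & nat & plan & plan
| Fork of nat & nat & nat & nat & nat & nat
| Paw of nat & nat & nat & nat & nat & nat.

Definition replies (V : seq nat) (l : nat) : edges :=
  (l, l.+1) :: [seq (a, l) | a <- V] ++ [seq (a, b) | a <- V, b <- V].

Fixpoint check (p : plan) (R B : edges) : bool :=
  match p with
  | Play x y p' =>
      let R' := (x, y) :: R in
      let V := undup (vertices R' ++ vertices B) in
      (* From the second round on, P2's previous reply brings at most two new labels and P1's edge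
         one; starting with 0 and 1, all labels stay below [l]. The next test verifies this. *)
      let l := (3 * size R').-1 in
      [&& free R B x y, all (fun a => a < l) V
        & all (fun e => ~~ ((e.1 < e.2) && free R' B e.1 e.2) || check p' R' (e :: B))
            (replies V l)]
  | If u v p1 p2 =>
      if B is e :: _ then if same u v e then check p1 R B else check p2 R B else false
  | Fork x y s t p q =>
      let R' := (x, y) :: R in
      [&& free R B x y, book2 R' s t p q, ~~ adj B s t, size B <= 6 & safeb 2 R' B]
  | Paw x y a b c d =>
      let R' := (x, y) :: R in
      [&& free R B x y, uniq [:: a; b; c; d],
          all (fun e => adj R' e.1 e.2) [:: (a, b); (a, c); (b, c); (a, d)],
          all (fun e => ~~ adj B e.1 e.2) [:: (a, b); (a, c)]
        & [&& free R' B d b, free R' B d c, size B <= 5 & safeb 3 R' B]]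
  end.

(** Vertices outside [V] are untouched, hence interchangeable: one such endpoint can be moved to
    [l], a second to [l.+1]. *)
Lemma replies_cover R B (V : seq nat) l :
  {subset vertices R <= V} -> {subset vertices B <= V} -> (forall a, a \in V -> a < l) ->
  (forall a b, (a, b) \in replies V l -> a < b -> free R B a b -> win R ((a, b) :: B)) ->
  forall u v, free R B u v -> win R ((u, v) :: B).
Proof.
move=> RV BV Vl W.
suff lt u v : u < v -> free R B u v -> win R ((u, v) :: B).
  move=> u v F; have /andP[uv _] := F; case: (ltngtP u v) => [uv'|vu|E].
  - exact: lt.
  - by apply: win_swap_last; apply: lt => //; rewrite freeC.
  - by rewrite E eqxx in uv.
have outR a : a \notin V -> a \notin vertices R by apply: contra => /RV.
have outB a : a \notin V -> a \notin vertices B by apply: contra => /BV.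
have nl a : l <= a -> a \notin V by move=> la; apply/negP => /Vl; rewrite ltnNge la.
have ll : l \notin V by exact: nl.
have freeN a b : a != b -> b \notin V -> free R B a b.
  move=> ab nb; rewrite /free ab /=; apply/andP; split; apply/negP => /adj_vertices/andP[_].
    by rewrite (negPf (outR _ nb)).
  by rewrite (negPf (outB _ nb)).
have one a b : a \in V -> b \notin V -> win R ((a, b) :: B).
  move=> aV bV; have al := Vl _ aV.
  have Wl : win R ((a, l) :: B).
    apply: W => //; first by rewrite inE mem_cat map_f ?orbT.
    by apply: freeN => //; rewrite neq_ltn al.
  have := win_swap (outR _ ll) (outR _ bV) (outB _ ll) (outB _ bV) Wl.
  rewrite /swap eqxx (ltn_eqF al); case: eqP => [E|//].
  by rewrite -E aV in bV.
move=> uv F; case: (boolP (u \in V)) => uV; case: (boolP (v \in V)) => vV.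
- apply: W => //; rewrite inE mem_cat; apply/orP; right; apply/orP; right.
  by apply/allpairsP; exists (u, v).
- exact: one.
- by apply: win_swap_last; apply: one.
have ll1 : l.+1 \notin V by apply: nl.
have W2 : win R ((l, l.+1) :: B).
  by apply: W => //; [rewrite inE eqxx | apply: freeN => //; rewrite neq_ltn ltnSn].
(* The first transposition sends [l] to [u] and [l.+1] to [m], which is [l] when [u] is [l.+1]; the
   second sends [m] to [v] and fixes [u]. *)
have := win_swap (outR _ ll) (outR _ uV) (outB _ ll) (outB _ uV) W2.
rewrite {1}/swap eqxx; set m := swap _ _ _ => Wm.
have mV : m \notin V by rewrite /m /swap; do 2!case: ifP => // _.
have um : u != m.
  rewrite /m /swap (gtn_eqF (ltnSn l)); case: (eqVneq l.+1 u) => [<-|].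
    by rewrite (gtn_eqF (ltnSn l)).
  by rewrite eq_sym.
have := win_swap (outR _ mV) (outR _ vV) (outB _ mV) (outB _ vV) Wm.
rewrite /swap eqxx (negPf um); case: eqP => [E|//].
by rewrite E ltnn in uv.
Qed.

Theorem check_win p R B : check p R B -> win R B.
Proof.
elim: p R B => [x y p IH|u v p IHp q IHq|x y s t p q|x y a b c d] R B.
- case/and3P => F /allP Vl /allP chk; apply: (win_step F).
  apply: (replies_cover (V := undup (vertices ((x, y) :: R) ++ vertices B))) Vl _.
  + by move=> a aR; rewrite mem_undup mem_cat aR.
  + by move=> a aB; rewrite mem_undup mem_cat aB orbT.
  move=> a b /chk /= /orP[/negP nF ab Fab|/IH //].
  by case: nF; rewrite ab.
- by case: B => //= e B; case: ifP => _; [apply: IHp | apply: IHq].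
- case/and5P => F B2 nst sz /safebP S; apply: (win_step F); exact: fork_reply B2 nst sz S.
- case/and5P => F U A nA /and4P[Fb Fc sz /safebP S]; apply: (win_step F).
  exact: paw_reply U A nA Fb Fc sz S.
Qed.

(** After the opening edge 01, P2's reply is 12, 23 or 02 up to renaming: the three main branches.
    Labels 4, 7, 10, 13, 16 are fresh vertices for P1's second to sixth edges. Every [Paw] hangs a
    fresh pendant vertex on a triangle; its bound [size B <= 5] still holds at the sixth edge. *)
Definition strategy_plan : plan :=
  (Play 0 1
   (If 1 2
    (Play 1 4
     (If 0 4
      (Play 1 7
       (If 0 7
        (Play 4 7
         (Paw 1 13 1 4 7 13))
       (Play 0 7
        (Paw 1 13 1 0 7 13))))
     (Play 0 4
      (Paw 1 10 1 0 4 10))))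
   (If 2 3
    (Play 0 4
     (If 1 4
      (Play 0 2
       (If 1 2
        (Play 2 4
         (If 3 4
          (Play 1 3
           (Paw 0 16 0 2 4 16))
         (If 0 3
          (Play 1 3
           (Paw 0 16 0 2 4 16))
         (Play 3 4
          (If 0 3
           (Paw 0 16 0 2 4 16)
          (Fork 0 3 0 4 2 3))))))
       (If 2 4
        (Play 1 2
         (If 1 3
          (Play 3 4
           (Paw 0 16 0 1 2 16))
         (If 0 3
          (Play 3 4
           (Paw 0 16 0 1 2 16))
         (Play 1 3
          (If 0 3
           (Paw 0 16 0 1 2 16)
          (Fork 0 3 0 1 2 3))))))
       (If 3 4
        (Play 1 2
         (If 2 4
          (Play 1 3
           (If 0 3
            (Paw 0 16 0 1 2 16)
           (Fork 0 3 0 1 2 3)))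
         (Fork 2 4 0 2 1 4)))
       (If 0 3
        (Play 1 2
         (Paw 0 13 0 1 2 13))
       (Play 2 4
        (If 1 2
         (Play 3 4
          (If 0 3
           (Paw 0 16 0 2 4 16)
          (Fork 0 3 0 4 2 3)))
        (Fork 1 2 0 2 1 4))))))))
     (Play 1 4
      (Paw 0 10 0 1 4 10))))
   (Play 0 4
    (If 1 4
     (Play 0 7
      (If 1 7
       (Play 4 7
        (Paw 0 13 0 4 7 13))
      (Play 1 7
       (Paw 0 13 0 1 7 13))))
    (Play 1 4
     (Paw 0 10 0 1 4 10))))))).

(* [vm_compute] is much slower here: it does not short-circuit [||] and [&&]. *)
Lemma win_start : win [::] [::].
Proof. by apply: (@check_win strategy_plan); lazy. Qed.

(** * From positions to histories *)

Local Notation board := (complete_graph nat).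
Local Notation legal := (legal_move board).

Lemma fset2_eq (a b x y : nat) :
  ([fset a; b] == [fset x; y])%fset = same x y (a, b).
Proof.
rewrite sameE; apply/eqP/orP => [E|[]/andP[/eqP-> /eqP->] //]; last by rewrite fsetUC.
have S z : (z \in [fset a; b]%fset) = (z \in [fset x; y]%fset) by rewrite E.
have := S a; have := S b; have := S x; have := S y; rewrite !inE !eqxx !orbT /=.
rewrite ![x == _]eq_sym ![y == _]eq_sym.
case: (eqVneq a x) => [->|ax]; case: (eqVneq b y) => [->|bY] /=; rewrite ?orbF.
- by left.
- by move=> /eqP xy _ /esym/eqP bx; rewrite bx xy eqxx in bY.
- by move=> _ /eqP yx _ /esym/eqP ay; rewrite ay yx eqxx in ax.
- by move=> _ _ <- <-; right.
Qed.

Lemma cardfs2_ex (K : choiceType) (e : {fset K}) :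
  #|` e| = 2 -> exists x y, x != y /\ e = [fset x; y]%fset.
Proof.
move=> c; have /fset0Pn[x xe] : e != fset0 by rewrite -cardfs_eq0 c.
have /cardfs1P[y ey] : #|` e `\ x|%fset == 1.
  by move: c; rewrite (cardfsD1 x) xe add1n => -[->].
exists x, y; split; last by rewrite -[LHS](fsetD1K xe) ey.
have : y \in (e `\ x)%fset by rewrite ey inE.
by rewrite !inE eq_sym => /andP[].
Qed.

(** The restriction to [x != y] is there because [[fset x; x]] is a singleton, not an edge. *)
Definition owns (p : player) (h : history nat) (E : edges) : Prop :=
  forall x y, x != y -> claimed p h [fset x; y]%fset <-> adj E x y.

Lemma claimed_rcons p (h : history nat) m e :
  claimed p (rcons h m) e <-> claimed p h e \/ (player_at (size h) = p /\ m = Some e).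
Proof.
split.
  case=> i [ip]; rewrite nth_rcons; case: ltngtP => // [_ E|E' E].
    by left; exists i.
  by right; rewrite -E' -ip.
case=> [[i [ip E]]|[hp ->]].
  exists i; split=> //; rewrite nth_rcons; case: ltngtP => // [H|H];
    move: E; rewrite nth_default //.
    exact: ltnW.
  by rewrite H.
by exists (size h); rewrite nth_rcons ltnn eqxx.
Qed.

Lemma claimed_mem p (h : history nat) e : claimed p h e -> Some e \in h.
Proof.
case=> i [_ E]; rewrite -E; apply: mem_nth; rewrite ltnNge; apply/negP => H.
by rewrite nth_default in E.
Qed.

Lemma mem_claimed (h : history nat) e : Some e \in h -> claimed P1 h e \/ claimed P2 h e.
Proof.
move=> H; have E := nth_index None H.
case O: (odd (index (Some e) h)); [right | left]; by exists (index (Some e) h).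
Qed.

Lemma owns_mine p h E x y : player_at (size h) = p -> owns p h E ->
  owns p (rcons h (Some [fset x; y]%fset)) ((x, y) :: E).
Proof.
move=> hp O a b ab; rewrite claimed_rcons adj_cons -fset2_eq; split.
  case=> [/(O _ _ ab) ->|[_ [->]]]; first by rewrite orbT.
  by rewrite eqxx.
by case/orP=> [/eqP->|/(O _ _ ab)]; [right | left].
Qed.

Lemma owns_other p h E m : player_at (size h) <> p -> owns p h E -> owns p (rcons h m) E.
Proof.
move=> hp O a b ab; rewrite claimed_rcons -(O _ _ ab); split; last by left.
by case=> // -[].
Qed.

Lemma free_legal h R B x y : owns P1 h R -> owns P2 h B ->
  free R B x y -> legal h (Some [fset x; y]%fset).
Proof.
move=> OR OB /and3P[xy nR nB]; split; first by rewrite /= cardfs2 xy.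
by apply/negP => /mem_claimed[/(OR _ _ xy)|/(OB _ _ xy)]; apply/negP.
Qed.

Lemma legal_free h R B m : owns P1 h R -> owns P2 h B -> legal h m ->
  m != None -> exists x y, m = Some [fset x; y]%fset /\ free R B x y.
Proof.
case: m => // e OR OB [/= c nh] _.
have [x [y [xy E]]] := cardfs2_ex c.
exists x, y; rewrite E; split=> //; rewrite /free xy /=.
by apply/andP; split; apply: contra nh; rewrite E;
  [move/(OR _ _ xy) | move/(OB _ _ xy)]; apply: claimed_mem.
Qed.

(** Pigeonhole on a star at 0 with one edge more than there are moves. Hence a pass is never legal
    on this board. *)
Lemma unclaimed_ex (h : history nat) : exists e, unclaimed board h e.
Proof.
pose f n : move nat := Some [fset 0; n.+1]%fset.
have inj : injective f by move=> a b [/eqP]; rewrite fset2_eq sameE /= eqSS orbF => /eqP.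
have /allPn[m /mapP[n _ ->] nh] : ~~ all (fun m => m \in h) [seq f n | n <- iota 0 (size h).+1].
  apply/negP => /allP S.
  have := uniq_leq_size _ S; rewrite map_inj_uniq // iota_uniq size_map size_iota ltnn.
  by move/(_ isT).
by exists [fset 0; n.+1]%fset; split=> //=; rewrite cardfs2.
Qed.

Lemma legal_not_None h : ~ legal h None.
Proof. by have [e] := unclaimed_ex h => U /(_ e). Qed.

(** A default that keeps the strategies built below legal on histories they are not designed for. *)
Lemma legal_strategy_ex p : exists s, legal_strategy board p s.
Proof.
have [s Hs] := functional_choice _ unclaimed_ex.
by exists (fun h => Some (s h)) => h _ _; apply: Hs.
Qed.

Lemma book_copy h p E : owns p h E -> contains_copy (Khat2 3) (claimed p h) <-> book E.
Proof.
move=> O; split.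
  case=> f [finj C].
  have ne a b : a != b -> f a != f b by move=> ab; rewrite (inj_eq finj).
  have A a b : a != b -> Khat2_edge [fset a; b]%fset -> adj E (f a) (f b).
    move=> ab K; rewrite -(O _ _ (ne _ _ ab)); have := C _ K.
    by rewrite imfset_fset2.
  pose j k (lt : k < 3) : 'I_2 + 'I_3 := inr (Ordinal lt).
  have B i (k : 'I_3) : adj E (f (inl i)) (f (inr k)) by apply: A => //; left; exists i, k.
  apply: (@bookI _ (f (inl ord0)) (f (inl ord_max)) (f (@j 0 isT)) (f (@j 1 isT)) (f (@j 2 isT))).
    by rewrite /= !inE !(inj_eq finj).
  by rewrite /= !B A //; right.
case=> u [v [w1 [w2 [w3 [U M]]]]].
pose idx (z : 'I_2 + 'I_3) : nat := match z with inl i => i | inr k => k.+2 end.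
pose f z := nth 0 [:: u; v; w1; w2; w3] (idx z).
have lt z : idx z < 5 by case: z => -[k /= lt]; [apply: leq_trans lt _ | ].
have finj : injective f.
  move=> z z' /eqP; rewrite nth_uniq ?lt // => /eqP.
  case: z z' => [[i li]|[k lk]] [[i' li']|[k' lk']] /= E'.
  - by congr inl; apply: val_inj.
  - by move: (li); rewrite E'.
  - by move: (li'); rewrite -E'.
  - by case: E' => E'; congr inr; apply: val_inj.
exists f; split=> // e K.
have A : all (fun e => adj E e.1 e.2) (book_edges u v w1 w2 w3).
  apply/allP => g gL; apply/negPn/negP => n; move/eqP: M; rewrite -leqn0 leqNgt -has_count.
  by case/negP; apply/hasP; exists g.
move: A => /= /and4P[uv uw1 vw1 /and5P[uw2 vw2 uw3 vw3 _]].
case: K => [[i [k ->]]|->]; rewrite imfset_fset2; apply/O; rewrite ?(inj_eq finj) //.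
by case: i k => [[|[|//]] li] [[|[|[|//]]] lk].
Qed.

Lemma mkseqS (r : run nat) n : mkseq r n.+1 = rcons (mkseq r n) (r n).
Proof. by rewrite /mkseq -addn1 iotaD map_cat cats1. Qed.

(** The winning condition relative to runs through [h], suited to induction on [win]. Legality is
    still demanded on all histories, so that strategies can be glued. *)
Definition wins_from (h : history nat) : Prop :=
  exists s, legal_strategy board P1 s
    /\ forall r, legal_run board r -> mkseq r (size h) = h ->
         (forall n, size h <= n -> player_at n = P1 -> r n = s (mkseq r n)) ->
         wins (Khat2 3) P1 r.

Lemma win_strategy R B : win R B -> forall h, player_at (size h) = P1 ->
  owns P1 h R -> owns P2 h B -> wins_from h.
Proof.
have [s0 L0] := legal_strategy_ex P1.
elim=> {}R {}B x y F.
  move=> Bk nBk h hp OR OB; pose m := Some [fset x; y]%fset : move nat.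
  exists (fun h' => if h' == h then m else s0 h'); split=> [h' L' p'|r Lr rh fol].
    by case: eqP => [->|_]; [apply: free_legal F | apply: L0].
  have rm : r (size h) = m by rewrite fol // rh eqxx.
  exists (size h).+1; rewrite mkseqS rh rm; split.
    by apply: (proj2 (book_copy _) Bk); apply: owns_mine.
  rewrite book_copy; first exact: nBk.
  by apply: owns_other OB; rewrite hp.
move=> _ IH h hp OR OB; pose m := Some [fset x; y]%fset : move nat.
have O1 : owns P1 (rcons h m) ((x, y) :: R) by apply: owns_mine.
have O2 : owns P2 (rcons h m) B by apply: owns_other OB; rewrite hp.
have hp' : player_at (size (rcons h m)) = P2.
  by rewrite size_rcons; move: hp; rewrite /player_at /= => ->.
(* Legality of [m'] is put inside the existential, so that choice yields a strategy for every [m'],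
   the default one for illegal moves. *)
have sub (m' : move nat) : exists s, legal_strategy board P1 s /\
    (legal (rcons h m) m' -> forall r, legal_run board r ->
      mkseq r (size h).+2 = rcons (rcons h m) m' ->
      (forall n, (size h).+2 <= n -> player_at n = P1 -> r n = s (mkseq r n)) ->
      wins (Khat2 3) P1 r).
  case: (classic (legal (rcons h m) m')) => [L|nL]; last by exists s0.
  have /(legal_free O1 O2 L)[u [v [E Fuv]]] : m' != None.
    by apply/negP => /eqP E; rewrite E in L; apply: legal_not_None L.
  have [|||s [Ls Ws]] := IH u v Fuv (rcons (rcons h m) m').
  - by rewrite size_rcons; move: hp'; rewrite /player_at /= => ->.
  - by apply: owns_other O1; rewrite hp'.
  - by rewrite E; apply: owns_mine.
  by exists s; split=> // _ r Lr; move: (Ws r Lr); rewrite !size_rcons.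
have [s Hs] := functional_choice _ sub.
(* P1's move [m] has index [size h], so P2's reply is at [(size h).+1] and selects the strategy to
   continue with. On shorter histories the lookup gives [None], whose strategy is legal too. *)
exists (fun h' => if h' == h then m else s (nth None h' (size h).+1) h').
split=> [h' L' p'|r Lr rh fol].
  by case: eqP => [->|_]; [apply: free_legal F | apply: (proj1 (Hs _))].
have rm : r (size h) = m by rewrite fol // rh eqxx.
have r1 : mkseq r (size h).+1 = rcons h m by rewrite mkseqS rh rm.
apply: (proj2 (Hs (r (size h).+1))) => //.
- by rewrite -r1.
- by rewrite mkseqS r1.
move=> n ln np; rewrite fol //; last by apply: leq_trans ln; apply: leqW.
case: eqP => [E|_]; last by rewrite nth_mkseq.
by have := congr1 size E; rewrite size_mkseq => E'; rewrite E' ltnNge leqnSn in ln.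
Qed.

Theorem theorem3p1 :
  has_winning_strategy (complete_graph nat) (Khat2 3) P1.
Proof.
have [|x y _|x y _|s [Ls Ws]] := @win_strategy _ _ win_start [::] => //.
- by split=> // -[i [_]]; rewrite nth_nil.
- by split=> // -[i [_]]; rewrite nth_nil.
by exists s; split=> // r Lr fol; apply: Ws => // n _; apply: fol.
Qed.
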